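(* Let $\xi,\Delta:\{t_0,t_0+1,\dots\}\to\mathbb R^+$ be such that $\Delta$ and $t\mapsto\xi_t\Delta_t$ are non-increasing and $\xi$ is non-decreasing. Let $F=\{\{f_{t,i}\}_{i=1}^{\ell_t}\}_{t\ge t_0}$ be a stream of real-valued queries with sensitivity $\Delta_{f_{t,i}}\le\Delta_t$ for all $(t,i)$, and let $T\in\mathbb R$. Then for any output $a$ in the range of NSG in which $h_t$ hard queries arrive at time $t$ for each $t\ge t_0$, and any neighboring database streams $D,D'$ of starting size $t_0$, $$\Pr[\mathrm{NSG}(D,F,T,\xi)=a]\le\exp\!\Big(\xi_{t_0}\Delta_{t_0}+\frac98\sum_{t\ge t_0}h_t\xi_t\Delta_t\Big)\Pr[\mathrm{NSG}(D',F,T,\xi)=a],$$ where for real-valued outputs ''probability'' is understood as density.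
   Context: A database stream $D=\{D_t\}_{t\ge t_0}$ consists of databases $D_t$ of size $t$ over a finite universe, with $D_{t+1}$ obtained from $D_t$ by adding one entry. Same-size databases are neighboring if they differ in one entry; streams $D,D'$ are neighboring if for some $t\ge t_0$, $D_\tau=D'_\tau$ for $t_0\le\tau<t$ and $D_\tau,D'_\tau$ are neighboring for all $\tau\ge t$. Query $f_{t,i}$ is a real-valued function on databases, arriving when the database has size $t$; its sensitivity $\Delta_{f_{t,i}}$ is $\max|f_{t,i}(E)-f_{t,i}(E')|$ over neighboring databases $E,E'$ of size $t$. $\mathrm{Lap}(b)$ has density $\frac1{2b}e^{-|z|/b}$. NATG (threshold $T$, noise function $\xi$): when started it draws $\eta\sim\mathrm{Lap}(2)$; on each subsequent query $f_{t,i}$ it draws fresh $\nu_{t,i}\sim\mathrm{Lap}(4/\xi_t)$; if $f_{t,i}(D_t)+\nu_{t,i}\ge T+\eta/\xi_t$ it outputs $f_{t,i}(D_t)+Z$, $Z\sim\mathrm{Lap}(8/\xi_t)$ fresh, and halts; otherwise outputs $\bot$. $\mathrm{NSG}(D,F,T,\xi)$: processes the queries in order; whenever a query arrives and no NATG instance is running, it starts a new NATG instance (fresh randomness) with the same $T,\xi$; it outputs the running instance's answer to each query. A query on which an NATG instance halts (i.e. receives a numeric answer) is called hard. *)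

(* Defs.v *)
From HB Require Import structures.
From mathcomp Require Import all_boot all_order all_algebra.
From mathcomp Require Import all_classical all_reals all_analysis.
Set Implicit Arguments.
Unset Strict Implicit.
Unset Printing Implicit Defensive.
Import Order.TTheory GRing.Theory Num.Theory.
Import numFieldNormedType.Exports.
Local Open Scope classical_set_scope.
Local Open Scope ring_scope.

(* All families indexed by the time t are functions on nat of which only the
   values at t >= t0 matter; the queries arriving at time t are numbered
   0, ..., l t - 1, and only the values at i < l t matter. *)

Section Databases.
Variables (R : realType) (U : finType).

Definition neighboring (t : nat) (E E' : t.-tuple U) : bool :=
  #|[set i : 'I_t | tnth E i != tnth E' i]%SET| == 1%N.

(* The new entry may be inserted at any position k. This covers both ordered
   databases (k = t) and multisets: two neighboring streams of multisets can
   always be listed as two neighboring streams of tuples in this sense. *)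
Definition database_stream (t0 : nat) (D : forall t, t.-tuple U) : Prop :=
  forall t, (t0 <= t)%N ->
    exists (k : nat) (x : U),
      tval (D t.+1) = take k (D t) ++ x :: drop k (D t).

Definition neighboring_streams (t0 : nat) (D D' : forall t, t.-tuple U) : Prop :=
  exists t, [/\ (t0 <= t)%N,
    forall s, (t0 <= s < t)%N -> D s = D' s &
    forall s, (t <= s)%N -> neighboring (D s) (D' s)].

Definition sensitivity (t : nat) (f : t.-tuple U -> R) : R :=
  \big[Num.max/0]_(p : t.-tuple U * t.-tuple U | neighboring p.1 p.2)
    `|f p.1 - f p.2|.

End Databases.

Section Noise.
Variable R : realType.

Definition laplace_pdf (b z : R) : R := (2 * b)^-1 * expR (- (`|z| / b)).

(* The random draws available to NSG: for each query (t, i), the threshold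
   noise of an instance started on that query, the noise of the comparison
   and the noise of the numeric answer. An instance is started on a query at
   most once, so all draws actually used are fresh. *)
Inductive draw : Type :=
  | ThresholdNoise of nat & nat
  | QueryNoise of nat & nat
  | AnswerNoise of nat & nat.

Definition draw_time (v : draw) : nat :=
  match v with
  | ThresholdNoise t _ => t
  | QueryNoise t _ => t
  | AnswerNoise t _ => t
  end.

Definition draw_scale (xi : nat -> R) (v : draw) : R :=
  match v with
  | ThresholdNoise _ _ => 2
  | QueryNoise t _ => 4 / xi t
  | AnswerNoise t _ => 8 / xi t
  end.

Section RandomVariables.
Variables (d : measure_display) (W : measurableType d) (P : probability W R).

Definition has_laplace_law (b : R) (X : {RV P >-> R}) : Prop :=
  forall A : set R, measurable A ->
    distribution P X A = (\int[lebesgue_measure]_(z in A) (laplace_pdf b z)%:E)%E.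

Definition mutually_independent (I : Type) (X : I -> {RV P >-> R}) : Prop :=
  forall (n : nat) (s : 'I_n -> I) (B : 'I_n -> set R),
    injective s -> (forall k, measurable (B k)) ->
    P (\bigcap_(k in [set: 'I_n]) (X (s k) @^-1` B k)) =
    (\prod_(k < n) P (X (s k) @^-1` B k))%E.

Definition nsg_noise (t0 : nat) (xi : nat -> R) (X : draw -> {RV P >-> R}) : Prop :=
  mutually_independent X /\
  forall v, (t0 <= draw_time v)%N -> has_laplace_law (draw_scale xi v) (X v).

End RandomVariables.
End Noise.

Section Algorithms.
Variables (R : realType) (U : finType).

(* Answers are of type option R, with None standing for bottom. *)
Definition natg_answer (T xit eta nu z v : R) : option R :=
  if T + eta / xit <= v + nu then Some (v + z) else None.

Variables (t0 : nat) (T : R) (xi : nat -> R) (l : nat -> nat).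
Variable f : forall t, nat -> t.-tuple U -> R.
Variable D : forall t, t.-tuple U.
Variable w : draw -> R.

(* The state of NSG is Some eta if an instance with threshold noise eta is
   running, and None if no instance is running. *)
Definition nsg_eta (st : option R) (t i : nat) : R :=
  if st is Some eta then eta else w (ThresholdNoise t i).

Definition nsg_answer (st : option R) (t i : nat) : option R :=
  natg_answer T (xi t) (nsg_eta st t i)
    (w (QueryNoise t i)) (w (AnswerNoise t i)) (f i (D t)).

Definition nsg_next (st : option R) (t i : nat) : option R :=
  if nsg_answer st t i is Some _ then None else Some (nsg_eta st t i).

Fixpoint nsg_state_in (st : option R) (t i : nat) : option R :=
  if i is j.+1 then nsg_next (nsg_state_in st t j) t j else st.

(* State just before the first query of time t0 + m. *)
Fixpoint nsg_state_at (m : nat) : option R :=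
  if m is k.+1 then nsg_state_in (nsg_state_at k) (t0 + k)%N (l (t0 + k)%N)
  else None.

Definition nsg (t i : nat) : option R :=
  nsg_answer (nsg_state_in (nsg_state_at (t - t0)) t i) t i.

End Algorithms.

Section Outputs.
Variables (R : realType) (t0 : nat) (l : nat -> nat).

Definition hard_count (a : nat -> nat -> option R) (t : nat) : nat :=
  (\sum_(i < l t) isSome (a t i))%N.

Definition finitely_many_hard (a : nat -> nat -> option R) : Prop :=
  exists n, forall t, (t0 <= t)%N -> (n <= t)%N -> hard_count a t = 0%N.

Definition answer_near (r : R) (x y : option R) : Prop :=
  match x, y with
  | None, None => True
  | Some x', Some y' => `|y' - x'| < r
  | _, _ => False
  end.

Variables (d : measure_display) (W : measurableType d) (P : probability W R).

(* p is the density at a of the law of the random output Y, with respect to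
   counting measure for the answers bottom and Lebesgue measure for the K
   numeric answers, i.e. the limit as r tends to 0 of
     P (Y has the same bottoms as a and numeric answers within r of those of a)
   over the volume (2 r)^K. If K = 0, p is just the probability that Y = a. *)
Definition output_density (Y : W -> nat -> nat -> option R)
    (a : nat -> nat -> option R) (p : R) : Prop :=
  exists n : nat,
    (forall t, (t0 <= t)%N -> (n <= t)%N -> hard_count a t = 0%N) /\
    fine (P [set w | forall t i, (t0 <= t)%N -> (i < l t)%N ->
                       answer_near r (a t i) (Y w t i)])
      / (2 * r) ^+ (\sum_(t0 <= t < n) hard_count a t)%N
    @[r --> 0^'+] --> p.

End Outputs.

Definition truncate_stream (n : nat) (l : nat -> nat) (t : nat) : nat :=
  if (t < n)%N then l t else 0%N.

Definition nsg_density (R : realType) (U : finType) (d : measure_display)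
    (W : measurableType d) (P : probability W R) (X : draw -> {RV P >-> R})
    (t0 : nat) (D : forall t, t.-tuple U) (l : nat -> nat)
    (f : forall t, nat -> t.-tuple U -> R) (T : R) (xi : nat -> R)
    (a : nat -> nat -> option R) (p : R) : Prop :=
  output_density t0 l P (fun w => nsg t0 T xi l f D (fun v => X v w)) a p.

(* Main.v *)
Require Import Defs.
From HB Require Import structures.
From mathcomp Require Import all_boot all_order all_algebra.
From mathcomp Require Import all_classical all_reals all_analysis.
From mathcomp Require Import measurable_realfun ring lra.
Import Order.TTheory GRing.Theory Num.Theory.
Import numFieldNormedType.Exports.
Local Open Scope classical_set_scope.
Local Open Scope ring_scope.

Set Implicit Arguments.
Unset Strict Implicit.
Unset Printing Implicit Defensive.

(** The output [a] determines which instance answers each query, so the event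
  that NSG outputs [a] up to [r] splits into comparisons of query noises with
  thresholds, and the answer noises lying in balls of radius [r]. The two parts
  are independent, so the density is the probability of the comparison pattern
  times the Laplace densities of the answer noises.

  Write [g t = xi t * Delta t]. Passing from [D] to [D'], shift the threshold
  noise of an instance started at time [s] by [g s]: since [g] is
  non-increasing, the bottoms are preserved, at a cost of [g s / 2]. For the
  numeric answer at time [t], shifting the query noise by
  [Delta t + g s / xi t] costs [(g t + g s) / 4], and the answer noise costs
  [g t / 8]. As an instance starts no earlier than the previous one halts, its
  [3/4 * g s] is charged to that halt, which gives [9/8 * g t] per hard query,
  and [3/4 * g t0] for the first instance.

  The shift is carried out without integrating over the thresholds: these are
  cut into cells of width [e], so that the pattern event is covered by
  countably many boxes whose shifts are disjoint and lie in the pattern event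
  of [D'], and then [e] tends to 0. *)

(** * The Laplace density under translation and on small balls *)

Section Laplace.
Context {R : realType}.
Implicit Types (b c s x z : R) (A B : set R).
Local Notation mu := (@lebesgue_measure R).

Lemma lebesgue_measure_translate c A : measurable A ->
  pushforward mu ((fun x => x - c) : _ -> measurableTypeR R) A = mu A.
Proof.
move=> mA; apply/esym/lebesgue_measure_unique => [|_ _ [[u v] _ <-]|//] /=; first exact: measurable_funB.
rewrite /pushforward.
have -> : (fun x => x - c) @^-1` `]u, v]%classic = `]u + c, v + c]%classic.
  apply/seteqP; split => x /=; rewrite !in_itv/= lerBlDr ltrBrDr //.
rewrite !lebesgue_measure_itv/= !lte_fin ltrD2r; case: ifPn => // _.
by rewrite -!EFinB opprD addrACA subrr addr0.
Qed.

Lemma laplace_pdf_gt0 b z : 0 < b -> 0 < laplace_pdf b z.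
Proof. by move=> b0; rewrite mulr_gt0 ?expR_gt0 ?invr_gt0 ?mulr_gt0. Qed.

Lemma laplace_pdf_ge0 b z : 0 < b -> 0 <= laplace_pdf b z.
Proof. by move=> b0; exact/ltW/laplace_pdf_gt0. Qed.

Lemma measurable_laplace_pdf b B : measurable_fun B (laplace_pdf b).
Proof.
apply: measurable_funTS; apply: measurable_funM => //.
apply: measurableT_comp => //; apply: measurableT_comp => //.
by apply: measurable_funM => //; exact: normr_measurable.
Qed.

(** Triangle inequality in the exponent; every factor paid for a shift below comes from this
    bound. *)
Lemma laplace_pdf_translate b x z : 0 < b ->
  laplace_pdf b x <= expR (`|x - z| / b) * laplace_pdf b z.
Proof.
move=> b0; rewrite /laplace_pdf mulrCA ler_pM2l ?invr_gt0 ?mulr_gt0//.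
rewrite -expRD ler_expR -mulNr -mulNr -mulrDl ler_pM2r ?invr_gt0//.
by rewrite lerBrDr addrC distrC lerB_dist.
Qed.

(** Translation invariance of [mu] moves the shift from the domain to the density, where the
    pointwise bound applies. *)
Lemma laplace_integral_translate b s B : 0 < b -> measurable B ->
  (\int[mu]_(z in B) (laplace_pdf b z)%:E <=
   (expR (`|s| / b))%:E *
   \int[mu]_(z in (fun x => x - s)%R @^-1` B) (laplace_pdf b z)%:E)%E.
Proof.
move=> b0 mB.
have ms : measurable_fun setT ((fun x => x - s) : _ -> measurableTypeR R).
  exact: measurable_funB.
have mB' : measurable ((fun x => x - s) @^-1` B).
  by rewrite -[X in measurable X]setTI; exact: (ms measurableT B mB).
have mpdf (D : set R) : measurable_fun D (fun z => (laplace_pdf b z)%:E).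
  by apply/measurable_EFinP; exact: measurable_laplace_pdf.
rewrite (eq_measure_integral (pushforward mu
  ((fun x => x - s) : measurableTypeR R -> measurableTypeR R))); last first.
  by move=> C mC _; rewrite [RHS]lebesgue_measure_translate.
rewrite ge0_integral_pushforward//; last 2 first.
- exact: mpdf.
- by move=> z _; rewrite lee_fin laplace_pdf_ge0.
rewrite -ge0_integralZl_EFin ?expR_ge0//; last 2 first.
- by move=> z _; rewrite lee_fin laplace_pdf_ge0.
- exact: mpdf.
apply: ge0_le_integral => //.
- by move=> z _; rewrite lee_fin laplace_pdf_ge0.
- exact: measurableT_comp (mpdf setT) (measurable_funTS ms).
- by apply: measurable_funeM; exact: mpdf.
- move=> z _ /=; rewrite -EFinM lee_fin (le_trans (laplace_pdf_translate _ z b0))//.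
  by rewrite addrAC subrr add0r normrN.
Qed.

(** On the ball the density differs from its value at the center by a factor of at most
    [expR (r / b)], and the ball has length [2 * r]. *)
Lemma laplace_integral_ball b c r : 0 < b -> 0 < r ->
  (((laplace_pdf b c * expR (- (r / b))) * (2 * r))%:E <=
     \int[mu]_(z in ball c r) (laplace_pdf b z)%:E <=
  ((laplace_pdf b c * expR (r / b)) * (2 * r))%:E)%E.
Proof.
move=> b0 r0.
have mpdf (D : set R) : measurable_fun D (fun z => (laplace_pdf b z)%:E).
  by apply/measurable_EFinP; exact: measurable_laplace_pdf.
have mball : measurable (ball c r : set (measurableTypeR R)) by exact: measurable_ball.
have E k : (\int[mu]_(z in ball c r) (cst k%:E) z = (k * (2 * r))%:E)%E.
  rewrite integral_cst//=; have := lebesgue_measure_ball c (ltW r0).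
  by rewrite /= => ->; rewrite -EFinM mulr_natl.
rewrite -2!E; apply/andP; split.
  apply: ge0_le_integral => //.
  - by move=> z _ /=; rewrite lee_fin mulr_ge0 ?expR_ge0 ?laplace_pdf_ge0.
  - by exact: mpdf.
  - move=> z zr; rewrite lee_fin expRN ler_pdivrMr ?expR_gt0//.
    rewrite (le_trans (laplace_pdf_translate _ z b0))// mulrC.
    by rewrite ler_pM2l ?laplace_pdf_gt0// ler_expR ler_pM2r ?invr_gt0// ltW.
apply: ge0_le_integral => //.
- by move=> z _; rewrite lee_fin laplace_pdf_ge0.
- by exact: mpdf.
- move=> z zr; rewrite lee_fin (le_trans (laplace_pdf_translate _ c b0))// mulrC.
  by rewrite ler_pM2l ?laplace_pdf_gt0// ler_expR ler_pM2r ?invr_gt0// ltW// distrC.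
Qed.

End Laplace.

(** * Random variables with a Laplace law *)

Section LaplaceVariable.
Context {R : realType} {d : measure_display} {W : measurableType d}.
Context {P : probability W R}.
Implicit Types (b c s : R) (X : {RV P >-> R}).

Lemma measurable_RV_preimage X (B : set R) : measurable B -> measurable (X @^-1` B).
Proof.
by move=> mB; rewrite -[X in measurable X]setTI; exact: measurable_funPT.
Qed.

Lemma laplace_law_translate b s X (B : set R) : 0 < b -> measurable B ->
  has_laplace_law b X ->
  fine (P (X @^-1` B)) <=
  expR (`|s| / b) * fine (P (X @^-1` ((fun x => x - s) @^-1` B))).
Proof.
move=> b0 mB lX.
have mB' : measurable ((fun x => x - s) @^-1` B).
  by rewrite -[X in measurable X]setTI; apply: measurable_funB.
rewrite -lee_fin EFinM !fineK ?fin_num_measure//; try exact: measurable_RV_preimage.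
have := laplace_integral_translate s b0 mB.
by rewrite -!lX.
Qed.

Lemma laplace_law_density b c X : 0 < b -> has_laplace_law b X ->
  fine (P (X @^-1` (ball c r))) / (2 * r) @[r --> 0^'+] --> laplace_pdf b c.
Proof.
move=> b0 lX.
have lim k : laplace_pdf b c * expR (k * r) @[r --> 0^'+] --> laplace_pdf b c.
  rewrite -[X in _ --> X]mulr1; apply: cvgM; first exact: cvg_cst.
  have -> : 1 = expR (k * 0) by rewrite mulr0 expR0.
  apply: (@cvg_comp _ _ _ (fun r => k * r) expR _ (nbhs (k * 0))).
    apply: cvgM; first exact: cvg_cst.
    exact/cvg_at_right_filter/cvg_id.
  exact: continuous_expR.
apply: (squeeze_cvgr _ (lim (- b^-1)) (lim b^-1)).
near=> r.
have r0 : 0 < r by [].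
have := laplace_integral_ball c b0 r0; rewrite -lX; last exact: measurable_ball.
rewrite -[distribution _ _ _]fineK ?fin_num_measure//; last exact: measurable_ball.
rewrite !lee_fin /= => /andP[H1 H2].
rewrite ler_pdivlMr ?mulr_gt0// ler_pdivrMr ?mulr_gt0//.
by rewrite mulNr mulrC [_^-1 * _]mulrC; apply/andP; split => //; rewrite mulrC.
Unshelve. all: by end_near. Qed.

End LaplaceVariable.

(** * Product events of independent variables *)

Section IndependentBoxes.
Context {R : realType} {d : measure_display} {W : measurableType d}.
Context {P : probability W R} {I : choiceType} (X : I -> {RV P >-> R}).
Implicit Types (B : I -> set R) (S : pred I) (s : seq I).

Definition box_event B : set W := [set w | forall v, B v (X v w)].

(** Only finitely many coordinates are constrained, so finite independence applies; [S] tells which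
    group of variables may be constrained. *)
Definition supported_box S B : Prop :=
  (forall v, measurable (B v)) /\
  exists s, forall v, ~~ ((v \in s) && S v) -> B v = setT.

(** A pi-system generating the sigma-algebra of the variables [X v] with [S v]. *)
Definition box_events S : set (set W) :=
  [set A | exists2 B, supported_box S B & A = box_event B].

Lemma box_event_bigcap B s : (forall v, v \notin s -> B v = setT) ->
  box_event B = \bigcap_(v in [set` s]) (X v @^-1` B v).
Proof.
move=> Bs; apply/seteqP; split => [w wB v _|w wB v]; first exact: wB.
by have [vs|/Bs ->//] := boolP (v \in s); exact: wB.
Qed.

Lemma measurable_box_event S B : supported_box S B -> measurable (box_event B).
Proof.
move=> [mB [s Bs]].
rewrite (@box_event_bigcap _ s); last by move=> v vs; rewrite Bs// (negbTE vs).
by rewrite bigcap_seq; apply: bigsetI_measurable => v _; exact: measurable_RV_preimage.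
Qed.

Lemma supported_boxI S B1 B2 : supported_box S B1 -> supported_box S B2 ->
  supported_box S (fun v => B1 v `&` B2 v).
Proof.
move=> [mB1 [s1 Bs1]] [mB2 [s2 Bs2]]; split=> [v|]; first exact: measurableI.
exists (s1 ++ s2) => v; rewrite mem_cat negb_and negb_or => H.
rewrite Bs1 ?Bs2 ?setTI// negb_and.
  by case/orP : H => [/andP[_ ->]//|->]; rewrite orbT.
by case/orP : H => [/andP[->]//|->]; rewrite orbT.
Qed.

Lemma box_eventI B1 B2 :
  box_event B1 `&` box_event B2 = box_event (fun v => B1 v `&` B2 v).
Proof.
by apply/seteqP; split => [w [w1 w2] v//|w wB]; split => v; have [] := wB v.
Qed.

Lemma setI_closed_box_events S : setI_closed (box_events S).
Proof.
move=> _ _ [B1 sB1 ->] [B2 sB2 ->]; rewrite box_eventI.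
by exists (fun v => B1 v `&` B2 v) => //; exact: supported_boxI.
Qed.

Hypothesis indep : mutually_independent X.

Lemma prob_box_event s B : uniq s -> (forall v, measurable (B v)) ->
  (forall v, v \notin s -> B v = setT) ->
  P (box_event B) = (\prod_(v <- s) fine (P (X v @^-1` B v)))%:E.
Proof.
move=> us mB Bs; rewrite (box_event_bigcap Bs).
have := @indep _ (tnth (in_tuple s)) (fun k => B (tnth (in_tuple s) k))
  (elimT (tuple_uniqP (in_tuple s)) us) (fun k => mB _).
move=> H; rewrite -prodEFin big_tnth.
transitivity (P (\bigcap_(k in [set: 'I_(size s)])
    (X (tnth (in_tuple s) k) @^-1` B (tnth (in_tuple s) k)))).
  congr (P _); apply/seteqP; split => [w wB k _|w wB v /= vs].
    by apply: wB; rewrite /= mem_tnth.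
  have /tnthP[k ->] : v \in in_tuple s by [].
  exact: wB.
rewrite H; apply: eq_bigr => k _; rewrite fineK// fin_num_measure//.
exact: measurable_RV_preimage.
Qed.

Lemma prob_box_eventI S B1 B2 : supported_box S B1 -> supported_box (predC S) B2 ->
  P (box_event B1 `&` box_event B2) = (P (box_event B1) * P (box_event B2))%E.
Proof.
move=> [mB1 [s1 Bs1]] [mB2 [s2 Bs2]].
pose s := undup (s1 ++ s2).
have us : uniq s by exact: undup_uniq.
have Bs1' v : v \notin s -> B1 v = setT.
  rewrite mem_undup mem_cat negb_or => /andP[vs _].
  by apply: Bs1; rewrite (negbTE vs).
have Bs2' v : v \notin s -> B2 v = setT.
  rewrite mem_undup mem_cat negb_or => /andP[_ vs].
  by apply: Bs2; rewrite (negbTE vs).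
rewrite box_eventI !(prob_box_event us)//; last 2 first.
- by move=> v; exact: measurableI.
- by move=> v vs; rewrite Bs1' ?Bs2' ?setTI.
rewrite -EFinM -big_split/=; congr (_%:E); apply: eq_bigr => v _.
have [Sv|Sv] := boolP (S v).
  by rewrite Bs2 ?setIT ?preimage_setT ?probability_setT ?mulr1//= Sv andbF.
by rewrite Bs1 ?setTI ?preimage_setT ?probability_setT ?mul1r//= (negbTE Sv) andbF.
Qed.

(** Both sides are finite measures in [A] that agree on the pi-system [box_events S], hence on the
    sigma-algebra it generates. This reaches events that are not boxes, such as comparisons between
    two draws. *)
Lemma prob_sigma_box_eventI S A B : <<s box_events S >> A ->
  supported_box (predC S) B ->
  P (A `&` box_event B) = (P A * P (box_event B))%E.
Proof.
move=> sA sB.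
have mB := measurable_box_event sB.
pose p : {nonneg R} := NngNum (fine_ge0 (measure_ge0 P (box_event B))).
have pE : P (box_event B) = (p%:num)%:E by rewrite fineK// fin_num_measure.
rewrite pE muleC -[LHS]/(mrestr P mB A) -[RHS]/(mscale p P A).
have GT : box_events S setT.
  exists (fun=> setT); last by rewrite /box_event; apply/seteqP; split.
  by split=> //; exists [::].
apply: (@g_sigma_algebra_measure_unique _ _ _ (box_events S) _ (fun=> setT)) => //.
- by move=> _ [C sC ->]; exact: measurable_box_event sC.
- by rewrite bigcup_const.
- exact: setI_closed_box_events.
- move=> _ [C sC ->]; have := prob_box_eventI sC sB; rewrite pE muleC.
  exact.
- move=> _; rewrite -[X in (X < _)%E]/(P (setT `&` box_event B)).
  by rewrite setTI pE ltry.
Qed.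

End IndependentBoxes.

(** An injective code, which gives [draw] the choice structure required of the index type of box
    events. *)
Definition draw_code (v : draw) : nat * nat * nat :=
  match v with
  | ThresholdNoise t i => (0, t, i)%N
  | QueryNoise t i => (1, t, i)%N
  | AnswerNoise t i => (2, t, i)%N
  end.

Definition draw_decode (c : nat * nat * nat) : draw :=
  match c.1.1 with
  | 0 => ThresholdNoise c.1.2 c.2
  | 1 => QueryNoise c.1.2 c.2
  | _ => AnswerNoise c.1.2 c.2
  end%N.

Lemma draw_codeK : cancel draw_code draw_decode.
Proof. by case. Qed.

HB.instance Definition _ := Choice.copy draw (can_type draw_codeK).

(** * A countable partition of the line into cells of width [e] *)

Section Cells.
Context {R : realType}.
Implicit Types (e x : R) (k : nat).

(** The cells are numbered by [nat] through [pickle], to fit countable unions; a number that codes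
    no integer gives the empty cell. *)
Definition cell e k : set R := [set x | pickle (Num.floor (x / e)) = k].

(** The left end of the cell; the default 0 occurs only for empty cells. *)
Definition cell_floor e k : R := (odflt 0 (pickle_inv k : option int))%:~R * e.

Lemma cell_bounds e k x : 0 < e -> cell e k x ->
  cell_floor e k <= x < cell_floor e k + e.
Proof.
move=> e0 <-; rewrite /cell_floor pickleK_inv/=.
have := floor_itv (x / e); rewrite ler_pdivlMr// ltr_pdivrMr//.
by rewrite intrD mulrDl mul1r.
Qed.

Lemma measurable_cell e k : 0 < e -> measurable (cell e k).
Proof.
move=> e0; have [[m mk]|no] := pselect (exists m : int, pickle m = k); last first.
  rewrite (_ : cell e k = set0)//; apply/seteqP; split => // x xk.
  by apply: no; exists (Num.floor (x / e)).
rewrite (_ : cell e k = `[m%:~R * e, (m + 1)%:~R * e[%classic)//.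
apply/seteqP; split => x; rewrite /cell/= in_itv/= -ler_pdivlMr// -ltr_pdivrMr//.
  by rewrite -mk => /(pcan_inj pickleK) <-; exact: floor_itv.
by move=> /floor_def ->.
Qed.

End Cells.

(** * Summing bounds over a partition, and removing the mesh *)

Section Measures.
Context {R : realType} {d : measure_display} {W : measurableType d}.

(** The pieces of [A] cut out by the [B k] exhaust it, and those of [A'] cut out by the [B' k] are
    disjoint, so the piecewise bounds add up. *)
Lemma le_measure_partition (P : {measure set W -> \bar R}) (A A' : set W)
    (B B' : nat -> set W) (C : R) : 0 <= C ->
  measurable A -> measurable A' ->
  (forall k, measurable (B k)) -> (forall k, measurable (B' k)) ->
  trivIset setT B -> trivIset setT B' -> \bigcup_k B k = setT ->
  (forall k, (P (A `&` B k) <= C%:E * P (A' `&` B' k))%E) ->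
  (P A <= C%:E * P A')%E.
Proof.
move=> C0 mA mA' mB mB' tB tB' BT PAB.
rewrite -[A]setIT -BT setI_bigcupr measure_bigcup; last 2 first.
- by move=> k _; exact: measurableI.
- exact: trivIset_setIl.
apply: (@le_trans _ _ (C%:E * P (\bigcup_k (A' `&` B' k)))%E); last first.
  rewrite lee_wpmul2l ?lee_fin//; apply: le_measure; rewrite ?inE//.
    by apply: bigcup_measurable => k _; exact: measurableI.
  by rewrite -setI_bigcupr; exact: subIsetl.
rewrite [in leRHS]measure_bigcup; last 2 first.
- by move=> k _; exact: measurableI.
- exact: trivIset_setIl.
by rewrite -nneseriesZl//; exact: lee_nneseries.
Qed.

Lemma measurable_ler_eqb (f g : W -> R) (b : bool) :
  measurable_fun setT f -> measurable_fun setT g ->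
  measurable [set w | (f w <= g w) == b].
Proof.
move=> mf mg; have := measurable_fun_le measurableT mf mg; rewrite setTI => mle.
case: b; first by rewrite (_ : mkset _ = [set w | f w <= g w])//; apply/seteqP; split=> w /eqP.
rewrite (_ : mkset _ = ~` [set w | f w <= g w]); first exact: measurableC.
by apply/seteqP; split=> w /=; [move=> /eqP ->|move/negP/negbTE ->].
Qed.

End Measures.

(** Since [x] and [y] do not depend on the mesh [e], the inequality survives the limit as [e] tends
    to 0 from the right. *)
Lemma ler_expR_perturb {R : realType} (x y c k : R) :
  (forall e, 0 < e -> x <= expR (c + k * e) * y) -> x <= expR c * y.
Proof.
move=> H.
have lim : expR (c + k * e) * y @[e --> 0^'+] --> expR c * y.
  apply: cvgM; last exact: cvg_cst.
  rewrite -[in X in _ --> X](addr0 c) -[in X in _ --> X](mulr0 k).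
  apply: (@cvg_comp _ _ _ (fun e => c + k * e) expR _ (nbhs (c + k * 0))).
    apply: cvgD; first exact: cvg_cst.
    apply: cvgM; first exact: cvg_cst.
    exact/cvg_at_right_filter/cvg_id.
  exact: continuous_expR.
apply: (ler_cvg_to (cvg_cst x) lim).
by near=> e; exact: H.
Unshelve. all: by end_near. Qed.

(** * Events prescribing the outcome of each comparison *)

Section ComparisonPattern.
Context {R : realType} (t0 : nat) (xi : nat -> R).
Hypothesis xi_gt0 : forall t, (t0 <= t)%N -> 0 < xi t.
Context {d : measure_display} {W : measurableType d} {P : probability W R}.
Variables (X : draw -> {RV P >-> R}).
Hypothesis X_noise : nsg_noise t0 xi X.
(* [start q] is the query on which the instance answering [q] was started. *)
Variables (start : nat * nat -> nat * nat) (hard : pred (nat * nat)).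
Implicit Types (al : nat * nat -> R) (q j : nat * nat) (Q J : seq (nat * nat)).

(** Here [al q] stands for [T] minus the value of the query, so the inequality is the test made by
    NATG. *)
Definition comparison al q (w : draw -> R) : bool :=
  (al q + w (ThresholdNoise (start q).1 (start q).2) / xi q.1
     <= w (QueryNoise q.1 q.2)) == hard q.

Definition pattern_event al Q : set W :=
  [set w | forall q, q \in Q -> comparison al q (X^~ w)].

Lemma measurable_pattern_event al Q : measurable (pattern_event al Q).
Proof.
rewrite (_ : pattern_event al Q =
    \bigcap_(q in [set` Q]) [set w | comparison al q (X^~ w)]).
  rewrite bigcap_seq; apply: bigsetI_measurable => q _.
  apply: measurable_ler_eqb => //.
  by apply: measurable_funD => //; exact: measurable_funM.
by [].
Qed.

(** * Shifting thresholds by [s] while the offsets move by at most [delta] *)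

Section Discretization.
Variables (al al' s delta : nat * nat -> R) (Q J : seq (nat * nat)).
Hypotheses (uniqQ : uniq Q) (uniqJ : uniq J).
Hypothesis Q_time : {in Q, forall q, (t0 <= q.1)%N}.
Hypothesis J_time : {in J, forall j, (t0 <= j.1)%N}.
Hypothesis startJ : {in Q, forall q, start q \in J}.
Hypothesis al_close : {in Q, forall q, `|al' q - al q| <= delta q}.
Hypothesis s_ge0 : {in J, forall j, 0 <= s j}.
Hypothesis s_large : {in Q, forall q, xi q.1 * delta q <= s (start q)}.

Section FixedMesh.
Variable e : R.
Hypothesis e_gt0 : 0 < e.

(** Within its cell a threshold is replaced by an endpoint, so that each constraint bears on a
    single draw and independence applies. *)
Definition cell_box (c : nat * nat -> nat) (v : draw) : set R :=
  match v with
  | ThresholdNoise t i => if (t, i) \in J then cell e (c (t, i)) else setT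
  | QueryNoise t i =>
      if (t, i) \in Q then
        let x := cell_floor e (c (start (t, i))) in
        if hard (t, i) then `[al (t, i) + x / xi t, +oo[%classic
        else `]-oo, al (t, i) + (x + e) / xi t[%classic
      else setT
  | AnswerNoise _ _ => setT
  end.

(** Thresholds move by [s + e] and not just [s]: the extra [e] makes up for the cell width when a
    bottom has to be preserved. *)
Definition shifted_cell_box (c : nat * nat -> nat) (v : draw) : set R :=
  match v with
  | ThresholdNoise t i =>
      if (t, i) \in J then (fun x => x - (s (t, i) + e)) @^-1` cell e (c (t, i))
      else setT
  | QueryNoise t i =>
      if (t, i) \in Q then
        let x := cell_floor e (c (start (t, i))) + (s (start (t, i)) + e) in
        if hard (t, i) then `[al' (t, i) + (x + e) / xi t, +oo[%classic
        else `]-oo, al' (t, i) + x / xi t[%classic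
      else setT
  | AnswerNoise _ _ => setT
  end.

(** The term [s + 2 * e] is the distance from the lower end of a cell to the upper end of its shift.
    A bottom costs nothing, as its half-line only grows. *)
Definition draw_cost (v : draw) : R :=
  match v with
  | ThresholdNoise t i => (s (t, i) + e) / 2
  | QueryNoise t i =>
      if hard (t, i)
      then (xi t * delta (t, i) + s (start (t, i)) + 2 * e) / 4 else 0
  | AnswerNoise _ _ => 0
  end.

Definition pattern_draws : seq draw :=
  [seq ThresholdNoise j.1 j.2 | j <- J] ++ [seq QueryNoise q.1 q.2 | q <- Q].

Lemma pattern_draws_uniq : uniq pattern_draws.
Proof.
rewrite cat_uniq !map_inj_uniq ?uniqQ ?uniqJ//=; last 2 first.
- by move=> [? ?] [? ?] [-> ->].
- by move=> [? ?] [? ?] [-> ->].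
by rewrite andbT; apply/hasPn => _ /mapP[q _ ->]; apply/mapP => -[].
Qed.

Lemma measurable_cell_box c v : measurable (cell_box c v).
Proof.
case: v => t i //=; case: ifP => // _; first exact: measurable_cell.
by case: ifP.
Qed.

Lemma measurable_shifted_cell_box c v : measurable (shifted_cell_box c v).
Proof.
case: v => t i //=; case: ifP => // _; last by case: ifP.
rewrite -[X in measurable X]setTI; apply: measurable_funB => //.
exact: measurable_cell.
Qed.

Lemma notin_pattern_draws v : v \notin pattern_draws ->
  match v with
  | ThresholdNoise t i => ((t, i) \in J) = false
  | QueryNoise t i => ((t, i) \in Q) = false
  | AnswerNoise _ _ => True
  end.
Proof.
rewrite mem_cat negb_or => /andP[vJ vQ]; case: v vJ vQ => t i //= vJ vQ.
  by apply/negP => tiJ; move/mapP : vJ; apply; exists (t, i).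
by apply/negP => tiQ; move/mapP : vQ; apply; exists (t, i).
Qed.

Lemma prob_cell_box_le c v : v \in pattern_draws ->
  fine (P (X v @^-1` cell_box c v)) <=
  expR (draw_cost v) * fine (P (X v @^-1` shifted_cell_box c v)).
Proof.
have pr_ge0 (A : set W) : 0 <= fine (P A) by exact: fine_ge0.
rewrite mem_cat => /orP[] /mapP[[t i] ti -> {v}] /=; rewrite ti.
  have b0 : 0 < 2 :> R by [].
  have t0t := J_time ti.
  apply: le_trans (laplace_law_translate (s (t, i) + e) b0 _ _) _.
  - exact: measurable_cell.
  - exact: X_noise.2.
  - by rewrite ger0_norm// addr_ge0 ?(ltW e_gt0)// s_ge0.
have xt : 0 < xi t by apply: xi_gt0; exact: Q_time ti.
case: ifP => hti.
  set x := cell_floor _ _; set sj := s (start (t, i)).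
  (* The shift carrying the end of the original half-line exactly to the end of the new one. *)
  pose del := al' (t, i) - al (t, i) + (sj + 2 * e) / xi t.
  have b0 : 0 < 4 / xi t by rewrite divr_gt0.
  have lX : has_laplace_law (4 / xi t) (X (QueryNoise t i)).
    by apply: (X_noise.2 (QueryNoise t i)); exact: Q_time ti.
  apply: le_trans (laplace_law_translate del b0 _ lX) _ => //.
  have -> : (fun x0 => x0 - del) @^-1` `[al (t, i) + x / xi t, +oo[%classic =
      `[al' (t, i) + (x + (sj + e) + e) / xi t, +oo[%classic.
    apply/seteqP; split => y; rewrite /= !in_itv/= !andbT lerBrDr /del => H.
      apply: le_trans H; rewrite le_eqVlt; apply/orP; left; apply/eqP.
      by field; rewrite gt_eqF.
    apply: le_trans H; rewrite le_eqVlt; apply/orP; left; apply/eqP.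
    by field; rewrite gt_eqF.
  apply: ler_wpM2r => //; rewrite ler_expR.
  have : `|del| <= delta (t, i) + (sj + 2 * e) / xi t.
    apply: le_trans (ler_normD _ _) _; apply: lerD; first exact: al_close.
    rewrite ger0_norm// divr_ge0 ?(ltW xt)// addr_ge0 ?mulr_ge0 ?(ltW e_gt0)//.
    by apply: s_ge0; exact: startJ.
  rewrite -(ler_pM2r xt) mulrDl divfK ?gt_eqF// => H.
  by rewrite invf_div mulrA ler_pM2r ?invr_gt0//; lra.
(* For a bottom the query noise is not shifted: [s_large] makes the first half-line a subset of the
   second. *)
rewrite expR0 mul1r fine_le ?fin_num_measure//; try exact: measurable_RV_preimage.
apply: le_measure; rewrite ?inE; try exact: measurable_RV_preimage.
move=> w /=; rewrite !in_itv/= => /lt_le_trans; apply.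
have := s_large ti; have := al_close ti; rewrite ler_norml => /andP[H1 _] /= H2.
set sj := s _ in H2 *; set x := cell_floor _ _.
have : delta (t, i) <= sj / xi t by rewrite ler_pdivlMr// mulrC.
have -> : (x + (sj + e)) / xi t = (x + e) / xi t + sj / xi t by rewrite -mulrDl; congr (_ / _); ring.
by lra.
Qed.

(* The upper cell bound is used for a bottom and the lower one for a numeric
   answer, so the boxes cover the event; [shifted_cell_box] makes the opposite
   choices, hence lies inside the event of the neighboring stream. *)
Lemma cell_box_sub c w :
  pattern_event al Q w ->
  {in J, forall j, cell e (c j) (X (ThresholdNoise j.1 j.2) w)} ->
  box_event X (cell_box c) w.
Proof.
move=> pw cw [] t i //=; case: ifPn => // ti; first exact: (cw (t, i)).
have := cell_bounds e_gt0 (cw _ (startJ ti)); have := pw _ ti.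
have xt : 0 < xi t by apply: xi_gt0; exact: Q_time ti.
rewrite /comparison/=; set eta := X (ThresholdNoise _ _) w.
case: ifPn => [hti|/negbTE hti] /eqP cmp /andP[lo hi]; rewrite /= in_itv/= ?andbT.
  by apply: le_trans cmp; rewrite lerD2l ler_pM2r ?invr_gt0.
move: cmp; rewrite leNgt => /negbFE /lt_le_trans; apply.
by rewrite lerD2l ler_pM2r ?invr_gt0// ltW.
Qed.

Lemma shifted_cell_box_sub c w :
  box_event X (shifted_cell_box c) w ->
  pattern_event al' Q w /\
  {in J, forall j, cell e (c j) (X (ThresholdNoise j.1 j.2) w - (s j + e))}.
Proof.
move=> bw.
have cw : {in J, forall j, cell e (c j) (X (ThresholdNoise j.1 j.2) w - (s j + e))}.
  by move=> [t i] ti; have := bw (ThresholdNoise t i); rewrite /= ti.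
split => // -[t i] ti; have := bw (QueryNoise t i); rewrite /= ti.
have xt : 0 < xi t by apply: xi_gt0; exact: Q_time ti.
have /andP[] := cell_bounds e_gt0 (cw _ (startJ ti)).
rewrite /comparison/=; set eta := X (ThresholdNoise _ _) w => lo hi.
case: ifPn => [hti|hti]; rewrite /= in_itv/= ?andbT => H; apply/eqP.
  apply: le_trans H; rewrite lerD2l ler_pM2r ?invr_gt0// ltW//.
  by move: hi; rewrite ltrBlDr addrAC.
apply/negbTE; rewrite -ltNge; apply: lt_le_trans H _.
by rewrite lerD2l ler_pM2r ?invr_gt0// -lerBrDr.
Qed.

Definition threshold_cells (J' : seq (nat * nat)) (c : nat * nat -> nat)
    (u : nat * nat -> R) : set W :=
  [set w | {in J', forall j, cell e (c j) (X (ThresholdNoise j.1 j.2) w - u j)}].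

Lemma measurable_threshold_cells J' c u : measurable (threshold_cells J' c u).
Proof.
rewrite (_ : threshold_cells J' c u =
    \bigcap_(j in [set` J']) (X (ThresholdNoise j.1 j.2) @^-1`
      ((fun x => x - u j) @^-1` cell e (c j))))//.
rewrite bigcap_seq; apply: bigsetI_measurable => j _.
apply: measurable_RV_preimage; rewrite -[X in measurable X]setTI.
by apply: measurable_funB => //; exact: measurable_cell.
Qed.

(** The event lies in the cell box, independence compares the two boxes draw by draw, and the
    shifted box lies in the event on the right. *)
Lemma pattern_cells_le c :
  (P (pattern_event al Q `&` threshold_cells J c (fun=> 0%R)) <=
   (expR (\sum_(v <- pattern_draws) draw_cost v))%:E *
   P (pattern_event al' Q `&` threshold_cells J c (fun j => s j + e)%R))%E.
Proof.
have mbox : measurable (box_event X (cell_box c)).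
  apply: (@measurable_box_event _ _ _ _ _ _ predT); split.
    exact: measurable_cell_box.
  exists pattern_draws => v; rewrite andbT => /notin_pattern_draws.
  by case: v => t i //= ->.
have mbox' : measurable (box_event X (shifted_cell_box c)).
  apply: (@measurable_box_event _ _ _ _ _ _ predT); split.
    exact: measurable_shifted_cell_box.
  exists pattern_draws => v; rewrite andbT => /notin_pattern_draws.
  by case: v => t i //= ->.
apply: (@le_trans _ _ (P (box_event X (cell_box c)))).
  apply: le_measure; rewrite ?inE//.
    by apply: measurableI; [exact: measurable_pattern_event|
                            exact: measurable_threshold_cells].
  move=> w [pw cw]; apply: cell_box_sub => // j jJ.
  by have := cw _ jJ; rewrite subr0.
apply: (@le_trans _ _ ((expR (\sum_(v <- pattern_draws) draw_cost v))%:E *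
                       P (box_event X (shifted_cell_box c)))%E); last first.
  rewrite lee_wpmul2l ?lee_fin ?expR_ge0//.
  apply: le_measure; rewrite ?inE//.
    by apply: measurableI; [exact: measurable_pattern_event|
                            exact: measurable_threshold_cells].
  by move=> w /shifted_cell_box_sub.
rewrite (prob_box_event X_noise.1 pattern_draws_uniq (measurable_cell_box c)); last first.
  by move=> v /notin_pattern_draws; case: v => t i //= ->.
rewrite (prob_box_event X_noise.1 pattern_draws_uniq (measurable_shifted_cell_box c)); last first.
  by move=> v /notin_pattern_draws; case: v => t i //= ->.
rewrite -EFinM lee_fin expR_sum -big_split/= !big_seq.
apply: ler_prod => v vs; rewrite prob_cell_box_le// andbT.
exact: fine_ge0.
Qed.

(* The thresholds are discretized one at a time: [J1] are those whose cell is
   already fixed. *)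
Lemma pattern_mesh_le :
  (P (pattern_event al Q) <=
   (expR (\sum_(v <- pattern_draws) draw_cost v))%:E * P (pattern_event al' Q))%E.
Proof.
set C := expR _.
suff H (J2 J1 : seq (nat * nat)) c : J1 ++ J2 = J ->
    (P (pattern_event al Q `&` threshold_cells J1 c (fun=> 0%R)) <=
     C%:E * P (pattern_event al' Q `&` threshold_cells J1 c (fun j => s j + e)%R))%E.
  have := H J [::] (fun=> 0%N) erefl.
  have cT u : threshold_cells [::] (fun=> 0%N) u = setT by apply/seteqP; split.
  by rewrite !cT !setIT.
elim: J2 J1 c => [J1 c|j J2 ih J1 c J12].
  by rewrite cats0 => ->; exact: pattern_cells_le.
have jJ1 : j \notin J1.
  by move: uniqJ; rewrite -J12 cat_uniq/= negb_or => /and3P[_ /andP[]].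
pose B u k : set W := [set w | cell e k (X (ThresholdNoise j.1 j.2) w - u)].
have mB u k : measurable (B u k).
  apply: (@measurable_RV_preimage _ _ _ _ _ ((fun x => x - u) @^-1` cell e k)).
  rewrite -[X in measurable X]setTI.
  by apply: measurable_funB => //; exact: measurable_cell.
have tB u : trivIset setT (B u) by move=> k1 k2 _ _ [w [<- <-]].
apply: (@le_measure_partition _ _ _ P _ _ (B 0) (B (s j + e))) => //.
- exact: expR_ge0.
- by apply: measurableI; [exact: measurable_pattern_event|
                          exact: measurable_threshold_cells].
- by apply: measurableI; [exact: measurable_pattern_event|
                          exact: measurable_threshold_cells].
- by apply/seteqP; split => // w _; eexists => //; reflexivity.
(* Intersecting with the [k]-th piece fixes the cell of [j]; as [j] is not in [J1], updating [c]
   there leaves the cells already fixed unchanged. *)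
move=> k; pose c' := [eta c with j |-> k].
have cB u : threshold_cells J1 c u `&` B (u j) k = threshold_cells (rcons J1 j) c' u.
  apply/seteqP; split=> [w [w1 w2] j'|w w1].
    rewrite mem_rcons inE => /predU1P[->|j'J1]; first by rewrite /= eqxx.
    rewrite /= ifN; first exact: w1.
    by apply: contraNneq jJ1 => <-.
  split.
    move=> j' j'J1; have := w1 j'; rewrite mem_rcons inE j'J1 orbT => /(_ isT).
    by rewrite /= ifN//; apply: contraNneq jJ1 => <-.
  by have := w1 j; rewrite mem_rcons inE eqxx => /(_ isT); rewrite /= eqxx.
rewrite -!setIA (cB (fun=> 0)) (cB (fun j => s j + e)).
by apply: ih; rewrite cat_rcons.
Qed.

End FixedMesh.

Lemma pattern_event_le :
  fine (P (pattern_event al Q)) <=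
  expR (\sum_(j <- J) s j / 2 +
        \sum_(q <- Q | hard q) (xi q.1 * delta q + s (start q)) / 4) *
  fine (P (pattern_event al' Q)).
Proof.
(* The coefficient of [e] in the total cost: [e / 2] per threshold and [2 * e / 4] per hard
   query. *)
pose k : R := \sum_(j <- J) 1 / 2 + \sum_(q <- Q | hard q) 1 / 2.
apply: (@ler_expR_perturb _ _ _ _ k) => e e0.
have := pattern_mesh_le e0.
rewrite -[P (pattern_event al Q)]fineK ?fin_num_measure//; last exact: measurable_pattern_event.
rewrite -[P (pattern_event al' Q)]fineK ?fin_num_measure//; last exact: measurable_pattern_event.
rewrite -EFinM lee_fin; congr (_ <= expR _ * _).
rewrite big_cat/= !big_map/= -big_mkcond/= [k * e]mulrDl !mulr_suml addrACA -!big_split/=.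
by congr (_ + _); apply: eq_big => [[t i]|[t i] _] //=; field.
Qed.

End Discretization.
End ComparisonPattern.

(** * The run of NSG read off from a fixed output *)

Section SymbolicRun.
Context {R : realType} (t0 : nat) (l : nat -> nat) (a : nat -> nat -> option R).
Implicit Types (st : option (nat * nat)) (q j : nat * nat).

(* These mirror [nsg_next], [nsg_state_in] and [nsg_state_at] along the output
   [a], recording the starting query of the running instance instead of the
   threshold noise drawn there. *)
Definition start_next st (t i : nat) : option (nat * nat) :=
  if a t i is Some _ then None else Some (odflt (t, i) st).

Fixpoint start_in st (t i : nat) : option (nat * nat) :=
  if i is i'.+1 then start_next (start_in st t i') t i' else st.

Fixpoint start_at (m : nat) : option (nat * nat) :=
  if m is k.+1 then start_in (start_at k) (t0 + k)%N (l (t0 + k)%N) else None.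

Definition running q : option (nat * nat) := start_in (start_at (q.1 - t0)) q.1 q.2.

(** If no instance is running when [q] arrives, one is started on [q] itself, hence the default. *)
Definition start_query q : nat * nat := odflt q (running q).

Definition is_query q : bool := (t0 <= q.1)%N && (q.2 < l q.1)%N.

Definition hard q : bool := isSome (a q.1 q.2).

Lemma runningS t i : running (t, i.+1) = start_next (running (t, i)) t i.
Proof. by []. Qed.

Lemma running_nextE m : running ((t0 + m).+1, 0)%N = running (t0 + m, l (t0 + m))%N.
Proof. by rewrite /running/= -addnS !addKn. Qed.

(** Induction in the order of arrival. The index [i = l t] is included: it describes the moment
    after the last query of time [t], which is also the beginning of time [t.+1]. *)
Lemma stream_ind (Pr : nat -> nat -> Prop) :
  Pr t0 0%N ->
  (forall t i, (t0 <= t)%N -> (i < l t)%N -> Pr t i -> Pr t i.+1) ->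
  (forall t, (t0 <= t)%N -> Pr t (l t) -> Pr t.+1 0%N) ->
  forall t i, (t0 <= t)%N -> (i <= l t)%N -> Pr t i.
Proof.
move=> P0 PS Pn t i t0t.
have Pin u : (t0 <= u)%N -> Pr u 0%N -> forall i, (i <= l u)%N -> Pr u i.
  by move=> t0u Pu; elim=> // k ih kl; apply: PS => //; apply: ih; exact: ltnW.
rewrite -(subnKC t0t); elim: (t - t0)%N i => [|m ih] i.
  by rewrite addn0; exact: Pin.
rewrite addnS; apply: Pin; first by rewrite leqW// leq_addr.
by apply: Pn; [rewrite leq_addr|exact: ih].
Qed.

Lemma running_next t : (t0 <= t)%N -> running (t.+1, 0%N) = running (t, l t).
Proof. by move=> t0t; rewrite -(subnKC t0t) running_nextE. Qed.

Lemma running0 : running (t0, 0%N) = None.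
Proof. by rewrite /running/= subnn. Qed.

Lemma running_Some t i j : (t0 <= t)%N -> (i <= l t)%N ->
  running (t, i) = Some j -> [/\ is_query j, (j.1 <= t)%N & running j = None].
Proof.
move=> t0t il; move: t i t0t il j; apply: stream_ind => [j|t i t0t il ih j|t t0t ih j].
- by rewrite running0.
- rewrite runningS /start_next; case: (a t i) => // -[<-].
  case E : (running (t, i)) => [k|] /=; first exact: ih.
  by split=> //; rewrite /is_query/= t0t.
- rewrite running_next// => /ih[qj jt rj]; split => //; exact: leqW.
Qed.

Lemma start_queryP q : is_query q ->
  [/\ is_query (start_query q), ((start_query q).1 <= q.1)%N &
      running (start_query q) = None].
Proof.
case: q => t i /andP[/= t0t il]; rewrite /start_query.
case E : (running (t, i)) => [j|] /=; first exact: running_Some (ltnW il) E.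
by split => //; rewrite /is_query/= t0t.
Qed.

(* The queries arriving at the times [t0], ..., [t0 + m - 1]. *)
Definition queries (m : nat) : seq (nat * nat) :=
  [seq ((t0 + k)%N, i) | k <- index_iota 0 m, i <- index_iota 0 (l (t0 + k))].

Lemma mem_queries m q : (q \in queries m) = is_query q && (q.1 < t0 + m)%N.
Proof.
apply/idP/idP.
  move=> /allpairsPdep[k [i]]; rewrite !mem_index_iota/= => -[km il ->].
  by rewrite /is_query/= leq_addr il ltn_add2l.
case: q => t i /andP[/andP[/= t0t il] tm]; apply/allpairsPdep.
exists (t - t0)%N, i; rewrite !mem_index_iota/= subnKC//; split => //.
by rewrite ltn_subLR.
Qed.

Lemma queries_uniq m : uniq (queries m).
Proof.
apply: allpairs_uniq_dep.
- exact: iota_uniq.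
- by move=> k _; exact: iota_uniq.
- by move=> [k i] [k' i'] _ _ /= [/addnI -> ->].
Qed.

Lemma big_queries (M : nmodType) m (Pr : pred (nat * nat)) (F : nat * nat -> M) :
  \sum_(q <- queries m | Pr q) F q =
  \sum_(0 <= k < m) \sum_(0 <= i < l (t0 + k) | Pr (t0 + k, i)%N) F (t0 + k, i)%N.
Proof.
rewrite big_mkcond big_allpairs_dep/=.
by apply: eq_bigr => k _; rewrite [RHS]big_mkcond.
Qed.

Lemma big_hard_queries (h : nat -> R) n :
  \sum_(q <- queries (n - t0) | hard q) h q.1 =
  \sum_(t0 <= t < n) (hard_count l a t)%:R * h t.
Proof.
rewrite big_queries -[in RHS](add0n t0) big_addn; apply: eq_bigr => k _.
rewrite addnC /hard_count natr_sum mulr_suml big_mkcond/= big_mkord.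
by apply: eq_bigr => i _; rewrite /hard/=; case: (a _ _) => [x|] /=; rewrite ?mul1r ?mul0r.
Qed.

Lemma count_hard_queries n :
  count hard (queries (n - t0)) = (\sum_(t0 <= t < n) hard_count l a t)%N.
Proof.
rewrite -sum1_count big_queries -[in RHS](add0n t0) big_addn; apply: eq_bigr => k _.
rewrite addnC /hard_count big_mkcond/= big_mkord.
by apply: eq_bigr => i _; rewrite /hard/=; case: (a _ _).
Qed.

(** * Amortized cost of the shifts *)

Section Cost.
Variable g : nat -> R.
Hypothesis g_ge0 : forall t, (t0 <= t)%N -> 0 <= g t.
Hypothesis g_noninc : forall s t, (t0 <= s)%N -> (s <= t)%N -> g t <= g s.

(** The shift costs arising at [q], for a threshold drawn there and for a query noise if [q] is
    hard, minus a charge of [g q.1] per hard query. *)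
Definition excess q : R :=
  (if running q is None then g q.1 / 2 else 0) +
  (if hard q then (g q.1 + g (start_query q).1) / 4 - g q.1 else 0).

(* The share of the cost of the running instance, or of the next one, that has
   not been charged yet. *)
Definition potential st (t : nat) : R :=
  if st is Some j then g j.1 / 4 else 3 / 4 * g t.

(** An exact balance. A start at time [s] spends [g s / 2] of [3/4 * g s] and keeps [g s / 4] for
    the halt; a halt at time [t] uses this and [g t / 4] of its charge, and the other [3/4 * g t] is
    set aside for the next instance. *)
Lemma excess_potential t i : (t0 <= t)%N ->
  excess (t, i) + potential (running (t, i.+1)) t = potential (running (t, i)) t.
Proof.
move=> t0t; rewrite runningS /excess /start_next /hard /start_query/=.
by case: (running (t, i)) => [j|]; case: (a t i) => [x|] /=; field.
Qed.

(** Within one time the balance is exact; between times the potential can only drop, because [g] is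
    non-increasing. It begins at [3/4 * g t0]. *)
Lemma sum_excess m :
  \sum_(q <- queries m) excess q + potential (running (t0 + m, 0)%N) (t0 + m)%N
  <= 3 / 4 * g t0.
Proof.
rewrite big_queries; elim: m => [|m ih].
  by rewrite big_nil add0r addn0 running0.
rewrite big_nat_recr//=; apply: le_trans ih; rewrite -addrA lerD2l.
have in_le i : (i <= l (t0 + m))%N ->
    \sum_(0 <= k < i) excess (t0 + m, k)%N +
      potential (running (t0 + m, i)%N) (t0 + m)%N =
    potential (running (t0 + m, 0)%N) (t0 + m)%N.
  elim: i => [|i ihi] il; first by rewrite big_nil add0r.
  rewrite big_nat_recr//= -addrA excess_potential ?leq_addr//.
  by apply: ihi; exact: ltnW.
rewrite -(in_le _ (leqnn _)) lerD2l addnS running_nextE.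
case: (running _) => //=; rewrite ler_pM2l//; first by apply: g_noninc; rewrite ?leq_addr.
Qed.

Lemma pattern_cost_le m :
  \sum_(q <- queries m | ~~ running q) g q.1 / 2 +
  \sum_(q <- queries m | hard q) (g q.1 + g (start_query q).1) / 4 <=
  3 / 4 * g t0 + \sum_(q <- queries m | hard q) g q.1.
Proof.
have pot_ge0 : 0 <= potential (running (t0 + m, 0)%N) (t0 + m)%N.
  case E : (running _) => [j|]; last by rewrite /= mulr_ge0// g_ge0// leq_addr.
  rewrite /= divr_ge0// g_ge0//.
  by have [/andP[]] := running_Some (leq_addr _ _) (leq0n _) E.
rewrite -lerBlDr -addrA -sumrB; apply: le_trans (sum_excess m).
apply: ler_wpDr => //; rewrite big_mkcond [X in _ + X]big_mkcond/= -big_split/=.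
by apply: ler_sum => q _; rewrite /excess; case: (running q).
Qed.

End Cost.
End SymbolicRun.

(** * The output event as comparisons and answer balls *)

Section NSGPattern.
Context {R : realType} {U : finType} (t0 : nat) (T : R) (xi : nat -> R).
Variables (l : nat -> nat) (f : forall t : nat, nat -> t.-tuple U -> R).
Variables (a : nat -> nat -> option R) (D : forall t : nat, t.-tuple U).
Implicit Types (w : draw -> R) (q : nat * nat).

Local Notation start := (start_query t0 l a).
Local Notation state w t i :=
  (nsg_state_in T xi f D w (nsg_state_at t0 T xi l f D w (t - t0)) t i).
Local Notation eta w := (fun j : nat * nat => w (ThresholdNoise j.1 j.2)).

Definition query_offset q : R := T - f q.2 (D q.1).

Definition answer_box (r : R) (v : draw) : set R :=
  match v with
  | AnswerNoise t i =>
      if is_query t0 l (t, i) then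
        if a t i is Some x then ball (x - f i (D t)) r else setT
      else setT
  | _ => setT
  end.

(** The hypothesis may use the state at the query in question: when only the comparisons are known,
    agreement of the answer with [a] is itself deduced from that state. *)
Lemma nsg_stateE w :
  (forall t i, (t0 <= t)%N -> (i < l t)%N ->
    state w t i = omap (eta w) (running t0 l a (t, i)) ->
    isSome (nsg t0 T xi l f D w t i) = isSome (a t i)) ->
  forall t i, (t0 <= t)%N -> (i <= l t)%N ->
    state w t i = omap (eta w) (running t0 l a (t, i)).
Proof.
move=> H; apply: (@stream_ind t0 l) => [|t i t0t il ih|t t0t ih].
- by rewrite running0 subnn.
- rewrite runningS /start_next /= {1}/nsg_next.
  have := H t i t0t il ih; rewrite /nsg.
  case: (nsg_answer _ _ _ _ _ _ _ _) => [x|]; case: (a t i) => // _.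
  by congr (Some _); rewrite ih; case: (running _ _ _ _).
- by rewrite running_next// -ih subSn//= subnKC.
Qed.

Lemma isSome_natg_answer (xit e nu z v : R) :
  isSome (natg_answer T xit e nu z v) = (T + e / xit <= v + nu).
Proof. by rewrite /natg_answer; case: ifP. Qed.

Lemma ball_answer (r v z x : R) : ball (x - v) r z = (`|v + z - x| < r) :> Prop.
Proof.
by rewrite /ball/= (_ : x - v - z = - (v + z - x)) ?normrN//; ring.
Qed.

Lemma comparisonE w t i :
  state w t i = omap (eta w) (running t0 l a (t, i)) ->
  comparison xi start (hard a) query_offset (t, i) w =
  (isSome (nsg t0 T xi l f D w t i) == isSome (a t i)).
Proof.
move=> st; rewrite /comparison /nsg /nsg_answer isSome_natg_answer st.
congr (_ == _); rewrite /query_offset/= addrAC lerBlDl.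
by congr (_ + _ / _ <= _); rewrite /start_query/=; case: (running _ _ _ _).
Qed.

(** The first condition involves only threshold and query noises, the second only answer noises,
    which prepares the factorization by independence. *)
Lemma answer_nearE (r : R) w :
  (forall t i, (t0 <= t)%N -> (i < l t)%N ->
    answer_near r (a t i) (nsg t0 T xi l f D w t i)) <->
  (forall q, is_query t0 l q -> comparison xi start (hard a) query_offset q w) /\
  (forall v, answer_box r v (w v)).
Proof.
split=> [near|[cmp box]].
  have iS t i : (t0 <= t)%N -> (i < l t)%N ->
      isSome (nsg t0 T xi l f D w t i) = isSome (a t i).
    by move=> t0t il; have := near t i t0t il; case: (a t i); case: (nsg _ _ _ _ _ _ _ _ _).
  have st := nsg_stateE (fun t i t0t il _ => iS t i t0t il).
  split=> [[t i] /andP[/= t0t il]|[] t i //=].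
    by rewrite comparisonE ?iS//; exact: st (ltnW il).
  case: ifP => // /andP[/= t0t il].
  have := near t i t0t il; case: (a t i) => // x.
  rewrite /nsg /nsg_answer /natg_answer; case: ifP => // _ /=.
  by rewrite ball_answer.
have st : forall t i, (t0 <= t)%N -> (i <= l t)%N ->
    state w t i = omap (eta w) (running t0 l a (t, i)).
  apply: nsg_stateE => t i t0t il st.
  by apply/eqP; rewrite -comparisonE//; apply: cmp; rewrite /is_query/= t0t.
move=> t i t0t il; have qti : is_query t0 l (t, i) by rewrite /is_query/= t0t.
have := cmp _ qti; rewrite comparisonE; last exact: st (ltnW il).
have := box (AnswerNoise t i); rewrite /= qti.
case: (a t i) => [x|]; last by case: (nsg _ _ _ _ _ _ _ _ _).
rewrite /nsg /nsg_answer /natg_answer; case: ifP => // _ /= + _.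
by rewrite ball_answer.
Qed.

End NSGPattern.

(** * The output density as pattern probability times Laplace densities *)

Section Density.
Context {R : realType} {U : finType} (t0 : nat) (T : R) (xi : nat -> R).
Hypothesis xi_gt0 : forall t, (t0 <= t)%N -> 0 < xi t.
Variables (l : nat -> nat) (f : forall t : nat, nat -> t.-tuple U -> R).
Variables (a : nat -> nat -> option R).
Context {d : measure_display} {W : measurableType d} {P : probability W R}.
Variables (X : draw -> {RV P >-> R}).
Hypothesis X_noise : nsg_noise t0 xi X.
Variable n : nat.
Hypothesis n_hard : forall t, (t0 <= t)%N -> (n <= t)%N -> hard_count l a t = 0%N.

Local Notation start := (start_query t0 l a).
Local Notation Qn := (queries t0 l (n - t0)).
Local Notation hardQ := [seq q <- Qn | hard a q].

Definition full_pattern (al : nat * nat -> R) : set W :=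
  [set w | forall q, is_query t0 l q -> comparison xi start (hard a) al q (X^~ w)].

Definition noise_center (D : forall t : nat, t.-tuple U) (q : nat * nat) : R :=
  odflt 0 (a q.1 q.2) - f q.2 (D q.1).

Definition nsg_density_at (D : forall t : nat, t.-tuple U) : R :=
  fine (P (full_pattern (query_offset T f D))) *
  \prod_(q <- hardQ) laplace_pdf (8 / xi q.1) (noise_center D q).

Lemma hard_in_queries q : is_query t0 l q -> hard a q -> q \in Qn.
Proof.
case: q => t i /andP[/= t0t il] hti; rewrite mem_queries /is_query/= t0t il/=.
have tn : (t < n)%N.
  rewrite ltnNge; apply/negP => nt; have := n_hard t0t nt.
  move/eqP; rewrite /hard_count sum_nat_eq0 => /forallP/(_ (Ordinal il)).
  by move: hti; rewrite /hard/=; case: (a t i).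
by rewrite subnKC// (leq_trans t0t (ltnW tn)).
Qed.

Lemma full_pattern_bigcap al : full_pattern al =
  \bigcap_m pattern_event xi X start (hard a) al (queries t0 l m).
Proof.
apply/seteqP; split=> w wq => [m _ q|q qq].
  by rewrite mem_queries => /andP[qq _]; exact: wq.
apply: (wq q.1.+1) => //; rewrite mem_queries qq/= addnS ltnS.
exact: leq_addl.
Qed.

Lemma measurable_full_pattern al : measurable (full_pattern al).
Proof.
rewrite full_pattern_bigcap; apply: bigcap_measurable => // m _.
exact: measurable_pattern_event.
Qed.

(** The pattern is decided by the threshold and query noises, through countably many comparisons, so
    it belongs to the sigma-algebra they generate. *)
Lemma full_pattern_sigma al :
  <<s box_events X (fun v => if v is AnswerNoise _ _ then false else true) >>
    (full_pattern al).
Proof.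
set S := fun v => _; set G := box_events X S.
(* With [W] carrying the generated sigma-algebra, membership becomes measurability and the usual
   closure properties apply. *)
rewrite -[_ (full_pattern al)]/(measurable (full_pattern al : set (g_sigma_algebraType G))).
have mX v : S v ->
    measurable_fun setT ((X v : W -> R) : g_sigma_algebraType G -> R).
  move=> Sv _ B mB; rewrite setTI; apply: sub_sigma_algebra.
  exists (fun u => if u == v then B else setT).
    split=> [u|]; first by case: ifP.
    by exists [:: v] => u; rewrite inE; case: eqP => // ->; rewrite Sv.
  apply/seteqP; split=> w wB; last by have := wB v; rewrite eqxx.
  by move=> u; case: eqP => // ->.
rewrite (_ : full_pattern al = \bigcap_t \bigcap_i
    [set w | is_query t0 l (t, i) ->
             comparison xi start (hard a) al (t, i) (X^~ w)]); last first.
  by apply/seteqP; split => [w wq t _ i _|w wq [t i]]; [exact: wq|exact: wq].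
apply: bigcap_measurable => // t _; apply: bigcap_measurable => // i _.
case: (boolP (is_query t0 l (t, i))) => _; last first.
  by rewrite (_ : mkset _ = setT)//; apply/seteqP; split.
rewrite (_ : mkset _ = [set w | comparison xi start (hard a) al (t, i) (X^~ w)]).
  apply: (@measurable_ler_eqb _ _ (g_sigma_algebraType G)); last exact: mX.
  by apply: measurable_funD => //; apply: measurable_funM => //; exact: mX.
by apply/seteqP; split => w /=; [exact|].
Qed.

Lemma supported_answer_box D r : supported_box
  (predC (fun v => if v is AnswerNoise _ _ then false else true))
  (answer_box t0 l f a D r).
Proof.
split.
  case=> t i //=; case: ifP => // _; case: (a t i) => // x.
  exact: measurable_ball.
exists [seq AnswerNoise q.1 q.2 | q <- hardQ] => -[] t i //=.
rewrite andbT; case: ifP => // qti; case ati : (a t i) => [x|]// /mapP[].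
have hti : hard a (t, i) by rewrite /hard/= ati.
by exists (t, i) => //; rewrite mem_filter hti hard_in_queries.
Qed.

Lemma prob_answer_near D r :
  fine (P [set w | forall t i, (t0 <= t)%N -> (i < l t)%N ->
    answer_near r (a t i) (nsg t0 T xi l f D (X^~ w) t i)]) =
  fine (P (full_pattern (query_offset T f D))) *
  \prod_(q <- hardQ)
    fine (P (X (AnswerNoise q.1 q.2) @^-1` ball (noise_center D q) r)).
Proof.
have -> : [set w | forall t i, (t0 <= t)%N -> (i < l t)%N ->
    answer_near r (a t i) (nsg t0 T xi l f D (X^~ w) t i)] =
    full_pattern (query_offset T f D) `&` box_event X (answer_box t0 l f a D r).
  by apply/seteqP; split => w; rewrite /mkset => /answer_nearE.
have sbox := supported_answer_box D r.
rewrite (prob_sigma_box_eventI X_noise.1 (full_pattern_sigma _) sbox).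
rewrite fineM ?fin_num_measure//; last 2 first.
- exact: measurable_full_pattern.
- exact: measurable_box_event sbox.
congr (_ * _).
rewrite (@prob_box_event _ _ _ _ _ _ X_noise.1 [seq AnswerNoise q.1 q.2 | q <- hardQ]).
- rewrite /= big_map [LHS]big_seq [RHS]big_seq; apply: eq_bigr => -[t i].
  rewrite mem_filter mem_queries /hard /noise_center /= => /andP[hti /andP[-> _]].
  by case: (a t i) hti.
- rewrite map_inj_uniq ?filter_uniq ?queries_uniq//.
  by move=> [? ?] [? ?] [-> ->].
- exact: sbox.1.
- move=> [] t i //= /mapP H; case: ifP => // qti; case ati : (a t i) => [x|]//.
  have hti : hard a (t, i) by rewrite /hard/= ati.
  by exfalso; apply: H; exists (t, i) => //; rewrite mem_filter hti hard_in_queries.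
Qed.

Lemma cvg_prod_seq (I : eqType) (s : seq I) (F : set_system R) (FF : Filter F)
    (u : I -> R -> R) (c : I -> R) :
  {in s, forall i, u i r @[r --> F] --> c i} ->
  \prod_(i <- s) u i r @[r --> F] --> \prod_(i <- s) c i.
Proof.
elim: s => [|i s ih] us.
  by under eq_fun do rewrite big_nil; rewrite big_nil; exact: cvg_cst.
under eq_fun do rewrite big_cons; rewrite big_cons; apply: cvgM.
  by apply: us; rewrite mem_head.
by apply: ih => j js; apply: us; rewrite in_cons js orbT.
Qed.

Lemma nsg_densityP D : nsg_density X t0 D l f T xi a (nsg_density_at D).
Proof.
exists n; split=> //; rewrite -count_hard_queries -size_filter.
under eq_fun do rewrite prob_answer_near -mulrA.
apply: cvgM; first exact: cvg_cst.
(* The volume contains one factor [2 * r] per hard query, so each ball probability is divided by its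
   own. *)
rewrite (_ : (fun r => _) = (fun r => \prod_(q <- hardQ)
  (fine (P (X (AnswerNoise q.1 q.2) @^-1` ball (noise_center D q) r)) / (2 * r)))); last first.
  by apply/funext => r; rewrite big_split/= -exprVn big_const_seq count_predT iter_mulr_1.
apply: cvg_prod_seq => -[t i]; rewrite mem_filter mem_queries => /andP[_ /andP[/andP[t0t _] _]].
by apply: laplace_law_density; [rewrite divr_gt0// xi_gt0|exact: (X_noise.2 (AnswerNoise t i))].
Qed.

End Density.

(** * Comparison of the densities for two streams with close query values *)

Section Comparison.
Context {R : realType} {U : finType} (t0 : nat) (T : R) (xi Delta : nat -> R).
Hypothesis xi_gt0 : forall t, (t0 <= t)%N -> 0 < xi t.
Hypothesis Delta_gt0 : forall t, (t0 <= t)%N -> 0 < Delta t.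
Hypothesis xiDelta_noninc : forall s t, (t0 <= s)%N -> (s <= t)%N ->
  xi t * Delta t <= xi s * Delta s.
Variables (l : nat -> nat) (f : forall t : nat, nat -> t.-tuple U -> R).
Variables (a : nat -> nat -> option R).
Context {d : measure_display} {W : measurableType d} {P : probability W R}.
Variables (X : draw -> {RV P >-> R}).
Hypothesis X_noise : nsg_noise t0 xi X.
Variable n : nat.
Hypothesis n_hard : forall t, (t0 <= t)%N -> (n <= t)%N -> hard_count l a t = 0%N.
Variables D D' : forall t : nat, t.-tuple U.
Hypothesis f_close : forall t i, (t0 <= t)%N -> (i < l t)%N ->
  `|f i (D t) - f i (D' t)| <= Delta t.

Local Notation start := (start_query t0 l a).
Local Notation pattern M D :=
  (pattern_event xi X start (hard a) (query_offset T f D) (queries t0 l M)).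
Local Notation cost :=
  (\sum_(q <- queries t0 l (n - t0) | hard a q) xi q.1 * Delta q.1).

(** The factor does not depend on [M], which permits the passage to infinitely many queries. *)
Lemma finite_pattern_le M : (n - t0 <= M)%N ->
  fine (P (pattern M D)) <=
  expR (3 / 4 * (xi t0 * Delta t0) + cost) * fine (P (pattern M D')).
Proof.
move=> nM; pose g t := xi t * Delta t.
have g_ge0 t : (t0 <= t)%N -> 0 <= g t.
  by move=> t0t; rewrite mulr_ge0 ?ltW ?xi_gt0 ?Delta_gt0.
(* The queries on which an instance starts, that is, the thresholds actually drawn. *)
pose J := [seq q <- queries t0 l M | ~~ running t0 l a q].
have Qq q : q \in queries t0 l M -> is_query t0 l q by rewrite mem_queries => /andP[].
have JQ : {subset J <= queries t0 l M} by move=> q; rewrite mem_filter => /andP[].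
apply: le_trans (@pattern_event_le _ t0 xi xi_gt0 _ _ _ X X_noise start (hard a)
  (query_offset T f D) (query_offset T f D') (fun j => g j.1) (fun q => Delta q.1)
  (queries t0 l M) J _ _ _ _ _ _ _ _) _.
- exact: queries_uniq.
- by rewrite filter_uniq ?queries_uniq.
- by move=> q /Qq/andP[].
- by move=> q /JQ/Qq/andP[].
- move=> q qQ; have [sq sqt rs] := start_queryP a (Qq _ qQ).
  rewrite mem_filter rs/= mem_queries sq/=; apply: leq_ltn_trans sqt _.
  by move: qQ; rewrite mem_queries => /andP[].
- move=> [t i] /Qq/andP[/= t0t il]; rewrite /query_offset/=.
  rewrite (_ : _ - _ = f i (D t) - f i (D' t)); first exact: f_close.
  by ring.
- by move=> q /JQ/Qq/andP[t0q _]; exact: g_ge0.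
- move=> q /Qq qq; have [/andP[t0s _] sqt _] := start_queryP a qq.
  exact: xiDelta_noninc.
rewrite ler_wpM2r ?fine_ge0// ler_expR big_filter.
apply: le_trans (@pattern_cost_le _ t0 l a g g_ge0 xiDelta_noninc M) _.
(* All hard queries arrive before time [n], so the later times contribute no charge. *)
rewrite lerD2l !big_queries (@big_cat_nat _ _ _ (n - t0))//= -lerBrDl subrr.
rewrite big_nat_cond big1// => k /andP[/andP[nk _] _].
rewrite big_nat_cond big1// => i /andP[/andP[_ il] hti].
have := hard_in_queries n_hard _ hti; rewrite mem_queries /is_query/= leq_addr il/=.
by move=> /(_ isT); rewrite ltn_add2l ltnNge nk.
Qed.

(** The finite patterns decrease to the full one, so continuity from above for [D'] gives the limit
    of the finite bounds. *)
Lemma full_pattern_le :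
  fine (P (full_pattern t0 xi l a X (query_offset T f D))) <=
  expR (3 / 4 * (xi t0 * Delta t0) + cost) *
  fine (P (full_pattern t0 xi l a X (query_offset T f D'))).
Proof.
set C := expR _; have C0 : 0 < C by exact: expR_gt0.
have mfp := measurable_full_pattern t0 xi l a X.
have lim : fine (P (pattern M D')) @[M --> \oo] -->
    fine (P (full_pattern t0 xi l a X (query_offset T f D'))).
  apply: fine_cvg; rewrite fineK ?fin_num_measure// full_pattern_bigcap.
  apply: nonincreasing_cvg_mu.
  - by rewrite ltey_eq fin_num_measure//; exact: measurable_pattern_event.
  - by move=> M; exact: measurable_pattern_event.
  - by rewrite -full_pattern_bigcap.
  - move=> M N MN; apply/subsetPset => w wN q.
    rewrite mem_queries => /andP[qq qM]; apply: wN; rewrite mem_queries qq/=.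
    by rewrite (leq_trans qM)// leq_add2l.
have limC : C * fine (P (pattern M D')) @[M --> \oo] -->
    C * fine (P (full_pattern t0 xi l a X (query_offset T f D'))).
  by apply: cvgM => //; exact: cvg_cst.
apply: (ler_cvg_to (cvg_cst _) limC); near=> M.
apply: le_trans (finite_pattern_le _); last by near: M; exists (n - t0)%N.
apply: fine_le; rewrite ?fin_num_measure//; try exact: measurable_pattern_event.
apply: le_measure; rewrite ?inE//; first exact: measurable_pattern_event.
by rewrite full_pattern_bigcap; exact: bigcap_inf.
Unshelve. all: by end_near. Qed.

Lemma nsg_density_at_le :
  nsg_density_at t0 T xi l f a X n D <=
  expR (xi t0 * Delta t0 +
        9 / 8 * \sum_(t0 <= t < n) (hard_count l a t)%:R * (xi t * Delta t)) *
  nsg_density_at t0 T xi l f a X n D'.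
Proof.
rewrite -(big_hard_queries t0 l a (fun t => xi t * Delta t) n).
set Qh := [seq q <- queries t0 l (n - t0) | hard a q].
have Qh_query q : q \in Qh -> is_query t0 l q.
  by rewrite mem_filter mem_queries => /and3P[].
have b_gt0 q : q \in Qh -> 0 < 8 / xi q.1.
  by move=> /Qh_query/andP[t0q _]; rewrite divr_gt0 ?xi_gt0.
have prod_ge0 E : 0 <= \prod_(q <- Qh) laplace_pdf (8 / xi q.1) (noise_center f a E q).
  by rewrite big_seq; apply: prodr_ge0 => q /b_gt0 b0; exact: laplace_pdf_ge0.
(* The center of each answer noise moves by at most [Delta t], which at scale [8 / xi t] costs
   [xi t * Delta t / 8]. *)
have answers : \prod_(q <- Qh) laplace_pdf (8 / xi q.1) (noise_center f a D q) <=
    expR (cost / 8) *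
    \prod_(q <- Qh) laplace_pdf (8 / xi q.1) (noise_center f a D' q).
  rewrite -[cost]big_filter mulr_suml expR_sum -big_split/= big_seq [leRHS]big_seq.
  apply: ler_prod => -[t i] tiQ; rewrite laplace_pdf_ge0 ?b_gt0//=.
  apply: le_trans (laplace_pdf_translate _ (noise_center f a D' (t, i)) (b_gt0 _ tiQ)) _ => /=.
  rewrite ler_wpM2r ?laplace_pdf_ge0 ?(b_gt0 _ tiQ)// ler_expR.
  have /andP[/= t0t il] := Qh_query _ tiQ.
  rewrite invf_div mulrA ler_pM2r ?invr_gt0// mulrC ler_pM2l ?xi_gt0//.
  rewrite /noise_center/= distrC (_ : _ - _ = f i (D t) - f i (D' t)).
    exact: f_close.
  by ring.
have full := full_pattern_le.
apply: le_trans (ler_pM _ _ full answers) _ => //; first exact: fine_ge0.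
rewrite mulrACA -expRD ler_wpM2r//; first by rewrite mulr_ge0 ?fine_ge0.
rewrite ler_expR.
(* Pattern and answers together charge [1 + 1/8 = 9/8] per hard query, and [3/4] of the initial term
   is bounded by the whole of it. *)
have : 0 <= xi t0 * Delta t0 by rewrite mulr_ge0 ?ltW ?xi_gt0 ?Delta_gt0.
by lra.
Qed.

End Comparison.

(** * From sensitivity and neighboring streams to the density bound *)

Lemma ler_sensitivity (R : realType) (U : finType) (t : nat) (h : t.-tuple U -> R)
    (E E' : t.-tuple U) : neighboring E E' -> `|h E - h E'| <= sensitivity h.
Proof.
move=> EE'; exact: (@le_bigmax_cond _ _ _ _ (E, E')
  (fun p => neighboring p.1 p.2) (fun p => `|h p.1 - h p.2|)).
Qed.

Lemma hard_count_truncate (R : realType) (n : nat) (l : nat -> nat)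
    (a : nat -> nat -> option R) (t : nat) :
  hard_count (truncate_stream n l) a t =
  if (t < n)%N then hard_count l a t else 0%N.
Proof.
by rewrite /hard_count /truncate_stream; case: ifP => // _; rewrite big_ord0.
Qed.

Theorem theorem36 (R : realType) (U : finType) (t0 : nat) (xi Delta : nat -> R)
  (xi_gt0 : forall t, (t0 <= t)%N -> 0 < xi t)
  (Delta_gt0 : forall t, (t0 <= t)%N -> 0 < Delta t)
  (Delta_noninc : forall s t, (t0 <= s)%N -> (s <= t)%N -> Delta t <= Delta s)
  (xiDelta_noninc : forall s t, (t0 <= s)%N -> (s <= t)%N ->
     xi t * Delta t <= xi s * Delta s)
  (xi_nondec : forall s t, (t0 <= s)%N -> (s <= t)%N -> xi s <= xi t)
  (l : nat -> nat) (f : forall t : nat, nat -> t.-tuple U -> R)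
  (f_sens : forall t i, (t0 <= t)%N -> (i < l t)%N ->
     sensitivity (f t i) <= Delta t)
  (T : R)
  (d : measure_display) (W : measurableType d) (P : probability W R)
  (X : draw -> {RV P >-> R}) (X_noise : nsg_noise t0 xi X)
  (a : nat -> nat -> option R)
  (D D' : forall t : nat, t.-tuple U)
  (D_stream : database_stream t0 D) (D'_stream : database_stream t0 D')
  (DD' : neighboring_streams t0 D D') :
  (finitely_many_hard t0 l a ->
   exists p p' : R,
     [/\ nsg_density X t0 D l f T xi a p,
         nsg_density X t0 D' l f T xi a p' &
         (p%:E <= expeR ((xi t0 * Delta t0)%:E + (9 / 8)%:E *
             \sum_(t0 <= t <oo) ((hard_count l a t)%:R * xi t * Delta t)%:E)
           * p'%:E)%E])
  /\
  (* Outputs with infinitely many numeric answers have no density as a whole;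
     for these the claim is about the output up to an arbitrary time n. *)
  (forall n : nat,
   exists p p' : R,
     [/\ nsg_density X t0 D (truncate_stream n l) f T xi a p,
         nsg_density X t0 D' (truncate_stream n l) f T xi a p' &
         p <= expR (xi t0 * Delta t0 + 9 / 8 *
             \sum_(t0 <= t < n) (hard_count l a t)%:R * xi t * Delta t)
           * p']).
Proof.
have f_close t i : (t0 <= t)%N -> (i < l t)%N ->
    `|f t i (D t) - f t i (D' t)| <= Delta t.
  move=> t0t il; case: DD' => s [t0s eqD nbD].
  have [ts|st] := ltnP t s.
    by rewrite eqD ?t0t// subrr normr0 ltW// Delta_gt0.
  by apply: le_trans (f_sens t i t0t il); apply: ler_sensitivity; exact: nbD.
split=> [[n n_hard]|n].
  exists (nsg_density_at t0 T xi l f a X n D), (nsg_density_at t0 T xi l f a X n D').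
  split; [exact: nsg_densityP|exact: nsg_densityP|].
  have := nsg_density_at_le T xi_gt0 Delta_gt0 xiDelta_noninc X_noise n_hard f_close.
  rewrite -lee_fin => /le_trans; apply; rewrite [leLHS]EFinM lee_wpmul2r//.
    rewrite lee_fin mulr_ge0 ?fine_ge0// big_seq; apply: prodr_ge0 => q.
    rewrite mem_filter mem_queries => /andP[_ /andP[/andP[t0q _] _]].
    by rewrite laplace_pdf_ge0// divr_gt0// xi_gt0.
  rewrite -[X in (X <= _)%E]/(expeR (_)%:E) lee_expeR EFinD leeD2l// [leLHS]EFinM.
  rewrite lee_wpmul2l ?lee_fin// -sumEFin.
  under eq_bigr do rewrite mulrA.
  (* The sum up to [n] is a partial sum of the series of nonnegative terms. *)
  apply: nneseries_lim_ge => t t0t _.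
  by rewrite lee_fin !mulr_ge0// ltW ?xi_gt0 ?Delta_gt0.
(* Truncation leaves no queries from time [n] on, so the case of finitely many hard queries applies
   with this same [n]. *)
have n_hard t : (t0 <= t)%N -> (n <= t)%N -> hard_count (truncate_stream n l) a t = 0%N.
  by move=> _ nt; rewrite hard_count_truncate ltnNge nt.
exists (nsg_density_at t0 T xi (truncate_stream n l) f a X n D),
  (nsg_density_at t0 T xi (truncate_stream n l) f a X n D').
split; [exact: nsg_densityP|exact: nsg_densityP|].
have f_close' t i : (t0 <= t)%N -> (i < truncate_stream n l t)%N ->
    `|f t i (D t) - f t i (D' t)| <= Delta t.
  by move=> t0t; rewrite /truncate_stream; case: ifP => // _; exact: f_close.
have := nsg_density_at_le T xi_gt0 Delta_gt0 xiDelta_noninc X_noise n_hard f_close'.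
congr (_ <= expR (_ + _ * _) * _); rewrite big_nat [RHS]big_nat.
by apply: eq_bigr => t /andP[_ tn]; rewrite hard_count_truncate tn mulrA.
Qed.
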